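(* Suppose $C_0(\Sigma)=[\xi,\eta]$ and $a\le\xi$. Let $n\ge1$ and, for $N>0$, let $x_{n,1}^N<\dots<x_{n,n}^N$ be the zeros of $p_n^N(a;x)$, let $x_{n,1}<\dots<x_{n,n}$ be the zeros of $p_n(x)$, and let $x_{n-1,1}^{**}<\dots<x_{n-1,n-1}^{**}$ be the zeros of $p_{n-1}^{**}(a;x)$. Then $$a<x_{n,1}^{N}<x_{n,1}<x_{n-1,1}^{**}<x_{n,2}^{N}<x_{n,2}<\cdots<x_{n-1,n-1}^{**}<x_{n,n}^{N}<x_{n,n}.$$ Moreover, each $x_{n,k}^{N}$ is a decreasing function of $N$ and, for each $k=1,\dots,n-1$, $$\lim_{N\to\infty}x_{n,1}^{N}=a,\qquad \lim_{N\to\infty}x_{n,k+1}^{N}=x_{n-1,k}^{**},$$ as well as $$\lim_{N\to\infty}N[x_{n,1}^{N}-a]=\frac{-p_n(a)}{B_n\,p_{n-1}^{**}(a;a)},$$ $$\lim_{N\to\infty}N[x_{n,k+1}^{N}-x_{n-1,k}^{**}]=\frac{-p_n(x_{n-1,k}^{**})}{B_n\,(x_{n-1,k}^{**}-a)\,[p_{n-1}^{**}(a;x)]'_{x=x_{n-1,k}^{**}}},$$ where $B_n=K_{n-1}(a,a)$ and $'$ denotes $d/dx$.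
   Context: $\mu$ is a positive Borel measure on $\mathbb R$ whose support $\Sigma$ has infinitely many points, with all moments finite. $C_0(\Sigma)$ is the convex hull of $\Sigma$. $\{p_n(x)\}_{n\ge0}$ is the sequence of monic orthogonal polynomials for $\mu$, with $\|p\|_\mu^2=\int p^2d\mu$, and $K_n(x,y)=\sum_{j=0}^n p_j(x)p_j(y)/\|p_j\|_\mu^2$. $\{p_n^{**}(a;x)\}_{n\ge0}$ is the sequence of monic orthogonal polynomials for $(x-a)^2d\mu(x)$. $\{p_n^{N}(a;x)\}_{n\ge0}$ is the sequence of monic orthogonal polynomials for $d\mu+N\delta_a$, with $\delta_a$ the unit point mass at $a$. *)

(* Defs.v *)
From HB Require Import structures.
From mathcomp Require Import all_boot all_order all_algebra.
From mathcomp Require Import all_classical all_reals all_analysis measurable_realfun.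

Set Implicit Arguments.
Unset Strict Implicit.
Unset Printing Implicit Defensive.

Import Order.TTheory GRing.Theory Num.Theory.
Import numFieldNormedType.Exports.

Local Open Scope classical_set_scope.
Local Open Scope ring_scope.

Definition measure_support (R : realType)
    (mu : {measure set (measurableTypeR R) -> \bar R}) : set R :=
  [set x | forall U : set R, open U -> U x -> (0 < mu U)%E].

Definition convex_hull (R : realType) (A : set R) : set R :=
  smallest (@convex_set R R^o) A.

Definition finite_moments (R : realType)
    (mu : {measure set (measurableTypeR R) -> \bar R}) : Prop :=
  forall k : nat, mu.-integrable setT (fun x : R => (x ^+ k)%:E).

Section square_weight.
Context (R : realType) (mu : {measure set (measurableTypeR R) -> \bar R}) (a : R).

Definition square_weight (A : set (measurableTypeR R)) : \bar R :=
  (\int[mu]_(x in A) (((x : R) - a) ^+ 2)%:E)%E.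

Let square_weight0 : square_weight set0 = 0%E.
Proof. by rewrite /square_weight integral_set0. Qed.

Let square_weight_ge0 A : (0 <= square_weight A)%E.
Proof. by apply: integral_ge0 => x _; rewrite lee_fin sqr_ge0. Qed.

Let square_weight_sigma_additive : semi_sigma_additive square_weight.
Proof.
apply: semi_sigma_additive_nng_induced => [|x]; last by rewrite lee_fin sqr_ge0.
apply/measurable_EFinP; apply: measurable_funX.
by apply: measurable_funB => //; exact: measurable_cst.
Qed.

HB.instance Definition _ := isMeasure.Build _ _ _ square_weight
  square_weight0 square_weight_ge0 square_weight_sigma_additive.

End square_weight.

Definition add_mass (R : realType)
    (mu : {measure set (measurableTypeR R) -> \bar R}) (a : R) (N : {nonneg R}) :
    {measure set (measurableTypeR R) -> \bar R} :=
  measure_add mu (mscale N (dirac (a : measurableTypeR R))).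

Definition monic_orthogonal (R : realType)
    (nu : {measure set (measurableTypeR R) -> \bar R}) (p : nat -> {poly R}) : Prop :=
  [/\ forall n, p n \is monic,
      forall n, size (p n) = n.+1 &
      forall m n, m != n -> \int[nu]_x ((p m).[x] * (p n).[x]) = 0].

Definition sqnorm (R : realType)
    (mu : {measure set (measurableTypeR R) -> \bar R}) (q : {poly R}) : R :=
  \int[mu]_x (q.[x] ^+ 2).

Definition CD_kernel (R : realType)
    (mu : {measure set (measurableTypeR R) -> \bar R}) (p : nat -> {poly R})
    (n : nat) (x y : R) : R :=
  \sum_(0 <= j < n.+1) (p j).[x] * (p j).[y] / sqnorm mu (p j).

(* x 1 < ... < x n are the zeros of q; values of x off 1..n are irrelevant *)
Definition increasing_zeros (R : realType) (q : {poly R}) (n : nat)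
    (x : nat -> R) : Prop :=
  (forall i j, (1 <= i)%N -> (i < j)%N -> (j <= n)%N -> x i < x j) /\
  (forall z, root q z <-> exists2 k, (1 <= k <= n)%N & z = x k).

(* Main.v *)
From HB Require Import structures.
Require Import Defs.
From mathcomp Require Import all_boot all_order all_algebra.
From mathcomp Require Import all_classical all_reals all_analysis.
From mathcomp Require Import ring lra zify measurable_realfun.
From mathcomp Require polyrcf.

Import Order.TTheory GRing.Theory Num.Theory.
Import numFieldNormedType.Exports.

Local Open Scope classical_set_scope.
Local Open Scope ring_scope.

(** Write L(q) for the integral of a polynomial q against mu, p_n for the monic
orthogonal polynomials of mu, s = p_(n-1)** for the one of degree n-1 attached
to the weight (x - a)^2, and T = (X - a) s, which is monic of degree n.  The
theorem is a statement about the zeros of a linear pencil: for every N > 0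

    (1 + N B) p_n^N = p_n + N B T,    B = K_(n-1)(a, a)

([christoffel_pencil]).  Indeed L(T q) = q(a) L(T) whenever deg q < n, because
q - q(a) is divisible by X - a and s is orthogonal for (x - a)^2 dmu; and
B L(T) = - p_n(a), by the reproducing property of the kernel applied to T - p_n
([christoffel_mass]).  Hence the point mass N q(a) p_n(a) is exactly compensated
by N B L(T q), and the right-hand side is orthogonal, for mu + N delta_a, to all
polynomials of degree less than n.

The zeros of T are a and those of s.  They interlace those of p_n.  To see this,
let x_k be a zero of p_n and write p_n = l (X - x_k).  As in Gauss quadrature,
L(f l) = f(x_k) L(l) for deg f <= n.  Taking f = T and f = l, together with the
two facts above, gives T(x_k) l(x_k) > 0 ([christoffel_sign]), so the sign of T
alternates along the zeros of p_n.

From there on only monic polynomials P and T with interlacing real zeros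
t_1 < x_1 < t_2 < x_2 < ... matter.  The sign of P + N B T changes on each
]t_k, x_k[, which locates all n zeros Z_k of the pencil.  Evaluating the pencil
of N_2 > N_1 at the k-th zero for N_1 shows that the zeros decrease; evaluating it
at any point of ]t_k, x_k] for large N shows that they tend to t_k; and, writing
T = S (X - t_k), the equation of the zero reads
N (Z_k - t_k) = - P(Z_k) / (B S(Z_k)), whose limit is the announced rate since
S(t_k) = T'(t_k).

The measure theory enters only through the linear form L and two properties.
The support is infinite and lies to the right of a, so L(q) > 0 for every nonzero
q that is nonnegative on [a, +oo[ ([Rintegral_horner_gt0]); and the integrals
against the two modified measures are L(q (X - a)^2) and L(q) + N q(a)
([Rintegral_square_weight], [Rintegral_add_mass]). *)

(** * Integrals of polynomials and the support of the measure *)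

(** The line is second countable: a point outside the support lies in a null
interval with rational endpoints, and there are countably many of those. *)
Lemma negligible_support_compl (R : realType)
  (mu : {measure set (measurableTypeR R) -> \bar R}) :
  mu.-negligible (~` measure_support mu).
Proof.
pose itv (u : rat * rat) : set (measurableTypeR R) :=
  `]ratr u.1, ratr u.2[%classic.
pose F (k : nat) : set (measurableTypeR R) :=
  if unpickle k is Some u then (if mu (itv u) == 0%E then itv u else set0)
  else set0.
apply: (@negligibleS _ _ _ mu (\bigcup_k F k)); last first.
  apply: negligible_bigcup => k; rewrite /F.
  case: (unpickle k) => [u|]; last exact: negligible_set0.
  case: eqP => [u0|_]; last exact: negligible_set0.
  by apply/negligibleP => //; exact: measurable_itv.
move=> x /existsNP[U /not_implyP[oU /not_implyP[Ux /negP]]].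
rewrite -leNgt => muU.
have /nbhs_ballP[e /= e0 xeU] : nbhs x U by exact: open_nbhs_nbhs.
have [q1 q1x] : exists q, ratr q \in `]x - e, x[.
  by apply: rat_in_itvoo; rewrite ltrBlDr ltrDl.
have [q2 q2x] : exists q, ratr q \in `]x, x + e[.
  by apply: rat_in_itvoo; rewrite ltrDl.
exists (pickle (q1, q2)); first exact: I.
rewrite /F pickleK.
suff /eqP -> : mu (itv (q1, q2)) = 0%E.
  by rewrite /itv /= in_itv /= (itvP q1x) (itvP q2x).
apply/eqP; rewrite eq_le measure_ge0 andbT; apply: le_trans muU.
apply: le_measure; rewrite ?inE; first exact: measurable_itv.
  exact: open_measurable.
move=> y; rewrite /itv /= in_itv /= => /andP[y1 y2]; apply: xeU.
rewrite /ball /= ltr_norml; have := itvP q1x; have := itvP q2x => h2 h1.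
have h3 : x - e < ratr q1 by rewrite h1.
have h4 : ratr q2 < x + e by rewrite h2.
by apply/andP; split; lra.
Qed.

Section moments.
Context (R : realType) (mu : {measure set (measurableTypeR R) -> \bar R}).
Hypothesis mu_moments : finite_moments mu.

Lemma integrable_horner (q : {poly R}) :
  mu.-integrable setT (fun x : R => (q.[x])%:E).
Proof.
under eq_fun do rewrite horner_coef -sumEFin.
apply: integrable_sum => //= i _.
under eq_fun do rewrite EFinM.
by apply: integrableZl => //; exact: mu_moments.
Qed.

Lemma Rintegral_horner_lin (c : R) (q r : {poly R}) :
  \int[mu]_x (c *: q + r).[x] = c * \int[mu]_x q.[x] + \int[mu]_x r.[x].
Proof.
rewrite -RintegralZl//; last exact: integrable_horner.
rewrite -RintegralD//.
- by apply: eq_Rintegral => x _; rewrite hornerD hornerZ.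
- under eq_fun do rewrite -hornerZ.
  exact: (integrable_horner (c *: q)).
- exact: integrable_horner.
Qed.

Lemma finite_moments_fin_num_fun : fin_num_fun mu.
Proof.
apply: lty_fin_num_fun; rewrite ltey_eq.
have := integrable_fin_num measurableT (mu_moments 0).
under eq_integral do rewrite expr0.
by rewrite integral_cst// mul1e => ->.
Qed.

(** Almost everywhere q equals |q|, so a zero integral would make the open set
where q does not vanish a null set; the support would then consist of roots
of q, of which there are finitely many. *)
Lemma Rintegral_horner_gt0 (a : R) (q : {poly R}) :
    infinite_set (measure_support mu) ->
    (forall x, measure_support mu x -> a <= x) ->
    (forall x, a <= x -> 0 <= q.[x]) -> q != 0 ->
  0 < \int[mu]_x q.[x].
Proof.
move=> suppoo supp_ge q_ge0 q0.
pose f (x : measurableTypeR R) : \bar R := (q.[x])%:E.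
have mf : measurable_fun [set: measurableTypeR R] f.
  by apply/measurable_EFinP; exact: measurable_poly.
have fi : mu.-integrable setT f by exact: integrable_horner.
have fabs : ae_eq mu setT f (fun x => `|f x|)%E.
  have := negligible_support_compl _ mu.
  apply: negligibleS => x /= + sx; apply => _.
  by rewrite /f /= ger0_norm// q_ge0// supp_ge.
have intE : (\int[mu]_x f x = \int[mu]_x `|f x|)%E.
  by apply: ae_eq_integral => //; exact: measurableT_comp.
apply: fine_gt0; rewrite ltey_eq (integrable_fin_num measurableT fi)// andbT.
rewrite intE lt_neqAle integral_ge0// andbT eq_sym; apply/eqP.
move=> /(ae_eq_integral_abs mu measurableT mf)/= ae0.
have [B Bsupp Bq] := infinite_set_fset (size q) suppoo.
have : (size (finmap.enum_fset B) < size q)%N.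
  apply: max_poly_roots => //; last exact: finmap.fset_uniq.
  apply/allP => x xB; apply/negPn/negP => qx.
  have Bx : measure_support mu x by apply: Bsupp.
  have oq : open [set y : R | q.[y] != 0].
    rewrite (_ : mkset _ = horner q @^-1` [set y | y != 0]); last by [].
    apply: open_comp => [y _|]; first exact: continuous_horner.
    exact: open_neq.
  have := Bx _ oq qx; apply/negP; rewrite -leNgt.
  suff -> : mu [set y : R | q.[y] != 0] = 0%E by [].
  apply/negligibleP; first exact: open_measurable.
  apply: negligibleS ae0 => y /= qy; rewrite /f => /(_ I) [].
  exact/eqP.
by rewrite ltnNge Bq.
Qed.

End moments.

Lemma support_ge (R : realType)
    (mu : {measure set (measurableTypeR R) -> \bar R}) (a xi eta : R) :
    convex_hull (measure_support mu) = `[xi, eta]%classic -> a <= xi ->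
  forall y, measure_support mu y -> a <= y.
Proof.
move=> hull axi y /(@sub_gen_smallest _ (@convex_set R R^o)).
rewrite -/(convex_hull _) hull /= in_itv/= => /andP[xiy _].
exact: le_trans xiy.
Qed.

(** * The weight (x - a)^2 and the added point mass *)

(** Carries the finite measure structure of a measure known to be finite by
hypothesis only, which the Radon-Nikodym derivative asks for. *)
Definition finite_copy {d} {T : measurableType d} {R : realType}
  (mu : {measure set T -> \bar R}) (mu_fin : fin_num_fun mu) :
  set T -> \bar R := mu.

HB.instance Definition _ d (T : measurableType d) (R : realType)
    (mu : {measure set T -> \bar R}) (mu_fin : fin_num_fun mu) :=
  Measure.copy (finite_copy mu mu_fin) mu.

HB.instance Definition _ d (T : measurableType d) (R : realType)
    (mu : {measure set T -> \bar R}) (mu_fin : fin_num_fun mu) :=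
  Measure_isFinite.Build d T R (finite_copy mu mu_fin) mu_fin.

Section perturbed_measures.
Context (R : realType) (mu : {measure set (measurableTypeR R) -> \bar R}).
Hypothesis mu_moments : finite_moments mu.
Variable a : R.

Let w (x : measurableTypeR R) : \bar R := (((x : R) - a) ^+ 2)%:E.

Let wE (x : R) : w x = ((('X - a%:P) ^+ 2).[x])%:E.
Proof. by rewrite /w !hornerE. Qed.

Let w_integrable : mu.-integrable setT w.
Proof.
by apply: eq_integrable (integrable_horner _ _ mu_moments _) => // x _; rewrite wE.
Qed.

(** By definition of the weighted measure, its Radon-Nikodym derivative is
(x - a)^2 almost everywhere, so for nonnegative f this is the change of
variables of Radon and Nikodym; the general case follows on positive and
negative parts, with no integrability assumption. *)
Lemma integral_square_weight (f : measurableTypeR R -> \bar R) :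
    measurable_fun setT f ->
  (\int[square_weight mu a]_x f x = \int[mu]_x (f x * w x))%E.
Proof.
have mw : measurable_fun setT w by exact: measurable_int w_integrable.
have w0 x : (0 <= w x)%E by rewrite lee_fin sqr_ge0.
suff ge0E (g : measurableTypeR R -> \bar R) : (forall x, 0 <= g x)%E ->
    measurable_fun setT g ->
    (\int[square_weight mu a]_x g x = \int[mu]_x (g x * w x))%E.
  move=> mf; rewrite [LHS]integralE [RHS]integralE.
  rewrite !ge0E//; [|exact: measurable_funeneg|exact: measurable_funepos].
  congr (_ - _)%E; apply: eq_integral => x _.
    by rewrite !funeposE maxe_pMl// mul0e.
  by rewrite !funenegE maxe_pMl// mul0e mulNe.
move=> g0 mg.
pose mu' : {finite_measure set (measurableTypeR R) -> \bar R} :=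
  finite_copy mu (finite_moments_fin_num_fun _ _ mu_moments).
have sw_fin : fin_num_fun (square_weight mu a).
  apply: lty_fin_num_fun; rewrite ltey_eq.
  by have /= -> := integrable_fin_num measurableT w_integrable.
pose sw' : {finite_measure set (measurableTypeR R) -> \bar R} :=
  finite_copy (square_weight mu a) sw_fin.
have dom : sw' `<< mu'.
  apply/null_content_dominatesP => A mA muA0.
  have : (\int[mu]_(x in A) w x = 0)%E.
    apply: null_set_integral => //.
    exact: measurable_funTS.
  by [].
have := Radon_Nikodym_SigmaFinite.change_of_variables dom g0 measurableT mg.
move=> /= <-.
apply: ae_eq_integral => //.
- apply: emeasurable_funM => //.
  exact: (measurable_int _ (Radon_Nikodym_SigmaFinite.f_integrable dom)).
- exact: emeasurable_funM.
suff : ae_eq mu setT (Radon_Nikodym_SigmaFinite.f sw' mu') w.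
  by apply: filterS => x + Dx => /(_ Dx) ->.
apply: integral_ae_eq => //.
  exact: (Radon_Nikodym_SigmaFinite.f_integrable dom).
move=> E _ mE.
by rewrite -(Radon_Nikodym_SigmaFinite.f_integral dom).
Qed.

Lemma Rintegral_square_weight (q : {poly R}) :
  \int[square_weight mu a]_x q.[x] = \int[mu]_x (q * ('X - a%:P) ^+ 2).[x].
Proof.
rewrite /Rintegral integral_square_weight; last first.
  by apply/measurable_EFinP; exact: measurable_poly.
by congr fine; apply: eq_integral => x _; rewrite hornerM EFinM wE.
Qed.

Lemma Rintegral_add_mass (N : {nonneg R}) (q : {poly R}) :
  \int[add_mass mu a N]_x q.[x] = \int[mu]_x q.[x] + N%:num * q.[a].
Proof.
have mq : measurable_fun [set: measurableTypeR R] (EFin \o horner q).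
  by apply/measurable_EFinP; exact: measurable_poly.
pose md := mscale N (dirac (a : measurableTypeR R)).
have dE (f : measurableTypeR R -> \bar R) : measurable_fun setT f ->
    (forall x, 0 <= f x)%E -> (\int[md]_x f x = N%:num%:E * f a)%E.
  by move=> mf f0; rewrite ge0_integral_mscale// integral_dirac// diracT mul1e.
have mdq : md.-integrable setT (EFin \o horner q).
  apply/integrableP; split => //.
  have mabs : measurable_fun setT (fun x : measurableTypeR R => `|(q.[x])%:E|)%E.
    by apply: measurableT_comp.
  by rewrite (dE _ mabs) /= ?ltry.

have dqE : (\int[md]_x (q.[x])%:E = (N%:num * q.[a])%:E)%E.
  rewrite integralE !dE//; [|exact: measurable_funeneg|exact: measurable_funepos].
  rewrite funeposE funenegE /= -!EFin_max -!EFinM -EFinB -mulrBr.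
  by case: (leP q.[a] 0) => q0; case: (leP (- q.[a]) 0) => q0'; congr (_ * _)%:E; lra.
have mui := integrable_horner _ _ mu_moments q.
have := integral_measure_add measurableT mui mdq.
rewrite /Rintegral /add_mass => ->; rewrite fineD ?dqE//.
exact: integrable_fin_num.
Qed.

End perturbed_measures.

(** * Positive linear forms and orthogonal polynomials *)

(** Beyond linearity, all that the algebraic part asks of a form. The forms of both
modified measures inherit it. *)
Definition positive_above {R : realFieldType} (a : R) (L : {poly R} -> R) :=
  forall q, (forall x, a <= x -> 0 <= q.[x]) -> q != 0 -> 0 < L q.

Definition monic_orthogonal_form {R : realFieldType} (L : {poly R} -> R)
    (p : nat -> {poly R}) :=
  [/\ forall n, p n \is monic, forall n, size (p n) = n.+1 &
      forall m n, m != n -> L (p m * p n) = 0].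

Section linear_forms.
Context {R : realFieldType}.
Implicit Types (L : {poly R} -> R) (p : nat -> {poly R}) (q r : {poly R}).

Lemma scalarD {L} : scalar L -> forall q r, L (q + r) = L q + L r.
Proof. by move=> Llin q r; have := Llin 1 q r; rewrite scale1r mul1r. Qed.

Lemma scalar0 {L} : scalar L -> L 0 = 0.
Proof.
by move=> Llin; have := Llin (-1) 0 0; rewrite scaler0 addr0 mulN1r addNr.
Qed.

Lemma scalarZ {L} : scalar L -> forall c q, L (c *: q) = c * L q.
Proof.
by move=> Llin c q; have := Llin c q 0; rewrite (scalar0 Llin) !addr0.
Qed.

Lemma scalar_mull {L} r : scalar L -> scalar (fun q => L (r * q)).
Proof. by move=> Llin c q q'; rewrite mulrDr -scalerAr Llin. Qed.

(** The p_j with j < n span the polynomials of degree less than n. *)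
Lemma scalar_monic_basis_eq0 L p n :
    scalar L -> (forall j, p j \is monic) -> (forall j, size (p j) = j.+1) ->
    (forall j, (j < n)%N -> L (p j) = 0) ->
  forall q, (size q <= n)%N -> L q = 0.
Proof.
move=> Llin pm ps; elim: n => [_ q|n IHn Lp q qn].
  by rewrite size_poly_leq0 => /eqP ->; rewrite scalar0.
rewrite -(subrKC (q`_n *: p n) q) Llin Lp// mulr0 add0r.
apply: IHn => [j jn|]; first by apply: Lp; rewrite ltnS ltnW.
apply/leq_sizeP => j; rewrite leq_eqVlt coefB coefZ => /predU1P[<-|nj].
  by have /monicP := pm n; rewrite lead_coefE ps => ->; rewrite mulr1 subrr.
have -> : q`_j = 0 by rewrite nth_default// (leq_trans qn).
by rewrite [(p n)`_j]nth_default ?ps// mulr0 subr0.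
Qed.

Lemma monic_orthogonal_lt L p n q :
    scalar L -> monic_orthogonal_form L p -> (size q <= n)%N -> L (p n * q) = 0.
Proof.
move=> Llin [pm ps po]; apply: (scalar_monic_basis_eq0 _ _ _ (scalar_mull _ Llin)) => //.
by move=> j jn; apply: po; rewrite gtn_eqF.
Qed.

Lemma size_monicB q r n : q \is monic -> r \is monic ->
  size q = n.+1 -> size r = n.+1 -> (size (q - r)%R <= n)%N.
Proof.
move=> /monicP qm /monicP rm qs rs; apply/leq_sizeP => j; rewrite coefB.
rewrite leq_eqVlt => /predU1P[<-|nj].
  by move: qm rm; rewrite !lead_coefE qs rs => -> ->; rewrite subrr.
by rewrite !nth_default ?qs ?rs// subrr.
Qed.

Lemma horner_split q (z : R) :
  exists2 r, q = q.[z]%:P + r * ('X - z%:P) & (size r <= (size q).-1)%N.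
Proof.
have /factor_theorem[r rE] : root (q - q.[z]%:P) z.
  by rewrite rootE !hornerE subrr.
exists r; first by rewrite -rE addrC subrK.
have [->|r0] := eqVneq r 0; first by rewrite size_poly0.
have qE : q = q.[z]%:P + r * ('X - z%:P) by rewrite -rE addrC subrK.
have rs : size (r * ('X - z%:P)) = (size r).+1.
  by rewrite size_Mmonic ?monicXsubC// size_XsubC addn2.
rewrite [in leqRHS]qE addrC size_polyDl rs//.
by rewrite (leq_ltn_trans (size_polyC_leq1 _))// ltnS size_poly_gt0.
Qed.

(** The quadrature principle: q is congruent to q(z) modulo X - z, and f is
orthogonal to the multiples of X - z of the degree of q or less. *)
Lemma scalar_horner_split L (f q : {poly R}) (z : R) : scalar L ->
    (forall r, (size r <= (size q).-1)%N -> L (f * (r * ('X - z%:P))) = 0) ->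
  L (f * q) = q.[z] * L f.
Proof.
move=> Llin Lf0; have [r qE rs] := horner_split q z.
by rewrite [in LHS]qE mulrDr scalarD// Lf0// addr0 mulrC mul_polyC scalarZ.
Qed.

(** If p_n = l (X - z) with z <= a, then l p_n = l^2 (X - z) is nonnegative on
[a, +oo[, so L(l p_n) > 0, against the orthogonality of p_n and l. *)
Lemma monic_orthogonal_root_gt L p n (a z : R) :
    scalar L -> positive_above a L -> monic_orthogonal_form L p ->
  root (p n) z -> a < z.
Proof.
move=> Llin Lpos po /factor_theorem[l pE]; rewrite ltNge; apply/negP => za.
have [pm ps _] := po.
have pn0 : p n != 0 by rewrite -size_poly_eq0 ps.
have l0 : l != 0 by apply: contraNneq pn0 => l0; rewrite pE l0 mul0r.
have ls : size l = n.
  by apply/succn_inj; rewrite -(ps n) pE size_Mmonic ?monicXsubC// size_XsubC addn2.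
have := monic_orthogonal_lt _ _ n l Llin po; rewrite ls leqnn => /(_ isT).
rewrite pE mulrAC => /eqP; apply/negP; rewrite gt_eqF// Lpos//.
  move=> x ax; rewrite !hornerE mulr_ge0 -?expr2 ?sqr_ge0// subr_ge0.
  exact: le_trans ax.
by rewrite mulf_neq0 ?mulf_neq0 ?polyXsubC_eq0.
Qed.

End linear_forms.

(** * The Christoffel transform and the pencil identity *)

Section christoffel.
Context {R : realFieldType} {a : R} {L : {poly R} -> R} {p : nat -> {poly R}}.
Context {m : nat} {s : {poly R}}.
Hypotheses (Llin : scalar L) (Lpos : positive_above a L).
Hypothesis p_orth : monic_orthogonal_form L p.
Hypotheses (s_monic : s \is monic) (s_size : size s = m.+1).
Hypothesis s_orth :
  forall r : {poly R}, (size r <= m)%N -> L (s * r * ('X - a%:P) ^+ 2) = 0.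

(** The polynomial s stands for the degree m member of the orthogonal sequence of
(x - a)^2 dmu, and B for the Christoffel-Darboux kernel at (a, a). *)
Let T := ('X - a%:P) * s.
Let B := \sum_(0 <= j < m.+1) (p j).[a] * (p j).[a] / L (p j ^+ 2).

Lemma sqr_form_gt0 (q : {poly R}) : q != 0 -> 0 < L (q ^+ 2).
Proof.
move=> q0; apply: Lpos => [x _|]; last by rewrite expf_neq0.
by rewrite horner_exp sqr_ge0.
Qed.

Lemma monic_orthogonal_sqr_gt0 j : 0 < L (p j ^+ 2).
Proof. by apply: sqr_form_gt0; have [pm _ _] := p_orth; rewrite monic_neq0. Qed.

Lemma CD_diagonal_gt0 : 0 < B.
Proof.
have [_ ps _] := p_orth.
rewrite /B big_nat_recl// ltr_wpDr//.
  apply: sumr_ge0 => j _.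
  by rewrite -expr2 divr_ge0 ?sqr_ge0// ltW// monic_orthogonal_sqr_gt0.
rewrite divr_gt0 ?monic_orthogonal_sqr_gt0// -expr2 exprn_even_gt0//=.
have [pm _ _] := p_orth.
have /size_poly1P[c c0 p0E] : size (p 0) == 1 by rewrite ps.
by rewrite p0E hornerC.
Qed.

Lemma christoffel_size : size T = m.+2.
Proof. by rewrite size_Mmonic ?polyXsubC_eq0// size_XsubC s_size. Qed.

Lemma christoffel_monic : T \is monic.
Proof. by rewrite monicMl// monicXsubC. Qed.

(** Modulo X - a the factor q is the constant q(a), and T times X - a is
(X - a)^2 s, where the orthogonality of s applies. So, up to the constant L(T),
the form q -> L(T q) is a point mass at a in degree at most m. *)
Lemma christoffel_form (q : {poly R}) : (size q <= m.+1)%N ->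
  L (T * q) = q.[a] * L T.
Proof.
move=> qs; apply: scalar_horner_split => // r rs.
rewrite (_ : _ * _ = s * r * ('X - a%:P) ^+ 2); last by rewrite /T; ring.
by apply: s_orth; apply: leq_trans rs _; rewrite -subn1 leq_subLR add1n.
Qed.

(** The kernel K(X, a) reproduces values at a in degree at most m; applied to
T - p_(m+1), whose leading terms cancel, it yields - p_(m+1)(a), and L(K T)
equals K(a, a) L(T) because q -> L(T q) is L(T) times a point mass. *)
Lemma christoffel_mass : B * L T = - (p m.+1).[a].
Proof.
have [pm ps po] := p_orth.
pose K := \sum_(0 <= j < m.+1) ((p j).[a] / L (p j ^+ 2)) *: p j.
have Ks : (size K <= m.+1)%N.
  rewrite /K big_mkord; apply: (leq_trans (size_sum _ _ _)).
  apply/bigmax_leqP => j _.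
  by rewrite (leq_trans (size_scale_leq _ _))// ps ltn_ord.
have Ka : K.[a] = B.
  rewrite /K horner_sum; apply: eq_bigr => j _.
  by rewrite hornerZ mulrAC.
have Kp j : (j < m.+1)%N -> L (K * p j) = (p j).[a].
  move=> jm; rewrite /K big_mkord (bigD1 (Ordinal jm))//= mulrDl scalarD//.
  rewrite -scalerAl scalarZ// -expr2 divfK ?gt_eqF ?monic_orthogonal_sqr_gt0//.
  rewrite mulr_suml (_ : L _ = 0) ?addr0//.
  apply: (big_ind (fun q => L q = 0)).
  - exact: scalar0.
  - by move=> q r Lq Lr; rewrite scalarD// Lq Lr addr0.
  - move=> i ij; have ij' : (i : nat) != j by exact: ij.
    by rewrite -scalerAl scalarZ// (po _ _ ij') mulr0.
have KL (q : {poly R}) : (size q <= m.+1)%N -> L (K * q) = q.[a].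
  move=> qs; apply/eqP; rewrite -subr_eq0; apply/eqP.
  apply: (scalar_monic_basis_eq0 (fun q => L (K * q) - q.[a]) p m.+1) => //.
    move=> c f g; rewrite mulrDr -scalerAr Llin hornerD hornerZ; ring.
  by move=> j jm; rewrite Kp// subrr.
have Ds : (size (T - p m.+1)%R <= m.+1)%N.
    exact: size_monicB christoffel_monic (pm _) christoffel_size (ps _).
have := KL _ Ds.
rewrite mulrBr -scaleN1r addrC Llin [K * T]mulrC christoffel_form//.
rewrite Ka [K * p _]mulrC monic_orthogonal_lt// mulr0 add0r => ->.
by rewrite /T !hornerE subrr mul0r add0r.
Qed.

(** The hypothesis on P is orthogonality for mu + N delta_a. The difference D of
the two sides has degree at most m, and both sides are orthogonal to it for that
measure, so the square norm of D vanishes. *)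
Lemma christoffel_pencil (N : R) (P : {poly R}) : 0 <= N ->
    P \is monic -> size P = m.+2 ->
    (forall q : {poly R}, (size q <= m.+1)%N -> L (P * q) + N * (P * q).[a] = 0) ->
  (1 + N * B) *: P = p m.+1 + (N * B) *: T.
Proof.
move=> N0 Pm Ps Pq; have [pm ps po] := p_orth.
apply/eqP; rewrite -subr_eq0; set D := _ - _.
have Ds : (size D <= m.+1)%N.
  have -> : D = (P - p m.+1) + (N * B) *: (P - T).
    by rewrite /D scalerDl scale1r scalerBr opprD addrACA.
  apply: (leq_trans (size_polyD _ _)); rewrite geq_max size_monicB//=.
  by rewrite (leq_trans (size_scale_leq _ _))// size_monicB
    ?christoffel_monic ?christoffel_size.
apply/negPn/negP => D0.
have : 0 < L (D ^+ 2) + N * (D ^+ 2).[a].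
  by rewrite ltr_wpDr ?sqr_form_gt0// mulr_ge0// horner_exp sqr_ge0.
have -> : L (D ^+ 2) =
    (1 + N * B) * L (P * D) + (- (N * B) * L (T * D) + -1 * L (p m.+1 * D)).
  (* One factor D is expanded into the three terms that define it. *)
  have -> : D ^+ 2 =
      (1 + N * B) *: (P * D) + (- (N * B) *: (T * D) + -1 *: (p m.+1 * D)).
    by rewrite expr2 {1}/D scaleN1r scaleNr -!mul_polyC; ring.
  by rewrite !Llin scalarZ.
rewrite christoffel_form// (monic_orthogonal_lt _ _ _ _ Llin p_orth Ds).
have TE : T.[a] = 0 by rewrite /T !hornerE subrr mul0r.
rewrite horner_exp.
have DE : D.[a] = (1 + N * B) * P.[a] - (p m.+1).[a].
  by rewrite /D hornerD hornerN hornerD !hornerZ TE mulr0 addr0.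
move/lt_eqF/negP; apply; apply/eqP.
have := Pq _ Ds; rewrite hornerM => /eqP; rewrite addr_eq0 => /eqP ->.
have -> : - (N * B) * (D.[a] * L T) = N * D.[a] * (p m.+1).[a].
  by rewrite -[(p m.+1).[a]]opprK -christoffel_mass; ring.
rewrite DE; ring.
Qed.

(** Both L(T l) = T(z) L(l) and L(l^2) = l(z) L(l) are quadrature formulas, since
the multiples of p_(m+1) = l (X - z) that arise have a cofactor of degree at most
m. The first is also l(a) L(T) = (z - a) l(a)^2 / B, so that both are
positive, and the sign of L(l) drops out of their product. *)
Lemma christoffel_sign (l : {poly R}) (z : R) :
    p m.+1 = l * ('X - z%:P) -> 0 < T.[z] * l.[z].
Proof.
move=> pE; have [pm ps po] := p_orth.
have pn0 : p m.+1 != 0 by rewrite -size_poly_eq0 ps.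
have l0 : l != 0 by apply: contraNneq pn0 => l0; rewrite pE l0 mul0r.
have ls : size l = m.+1.
  by apply/succn_inj; rewrite -(ps m.+1) pE size_Mmonic ?monicXsubC// size_XsubC addn2.
have root_gt y : root (p m.+1) y -> a < y.
  exact: monic_orthogonal_root_gt Llin Lpos p_orth.
have az : a < z.
  by apply: root_gt; rewrite pE rootM root_XsubC eqxx orbT.
have la : l.[a] != 0.
  apply/negP => /rootP la; suff /root_gt : root (p m.+1) a by rewrite ltxx.
  by rewrite pE rootM /root la eqxx.
have TlE : L (T * l) = T.[z] * L l.
  rewrite mulrC; apply: scalar_horner_split => // r rs.
  rewrite (_ : _ * _ = p m.+1 * r); last by rewrite pE; ring.
  apply: (monic_orthogonal_lt _ _ _ _ Llin p_orth).
  by apply: leq_trans rs _; rewrite christoffel_size.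
have llE : L (l ^+ 2) = l.[z] * L l.
  rewrite expr2; apply: scalar_horner_split => // r rs.
  rewrite (_ : _ * _ = p m.+1 * r); last by rewrite pE; ring.
  apply: (monic_orthogonal_lt _ _ _ _ Llin p_orth).
  by apply: leq_trans rs _; rewrite ls leqW.
(* After multiplication by B > 0 the claim becomes 0 < l(a)^2 (z - a). *)
have Tl_gt0 : 0 < T.[z] * L l.
  rewrite -TlE christoffel_form ?ls//.
  rewrite -(pmulr_rgt0 _ CD_diagonal_gt0) mulrCA christoffel_mass pE !hornerE.
  rewrite (_ : _ * _ = l.[a] ^+ 2 * (z - a)); last by ring.
  by rewrite mulr_gt0 ?subr_gt0// exprn_even_gt0.
have ll_gt0 : 0 < l.[z] * L l by rewrite -llE sqr_form_gt0.
have := mulr_gt0 Tl_gt0 ll_gt0.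
rewrite mulrACA pmulr_lgt0// -expr2 exprn_even_gt0//=.
by apply: contraTneq ll_gt0 => ->; rewrite mulr0 ltxx.
Qed.

End christoffel.

(** * Polynomials with increasingly enumerated zeros *)

Section zeros.
Context {R : realType}.
Implicit Types (q l : {poly R}) (z y u v : nat -> R) (n k : nat).

Lemma prod_subr_gt0 z (w : R) i j :
  (forall k, (i <= k < j)%N -> z k < w) -> 0 < \prod_(i <= k < j) (w - z k).
Proof.
move=> zw; rewrite big_nat_cond; apply: prodr_gt0 => k.
by rewrite andbT => /zw; rewrite subr_gt0.
Qed.

Lemma prod_subr_sign z (w : R) i j :
  (forall k, (i <= k < j)%N -> w < z k) ->
  0 < (-1) ^+ (j - i) * \prod_(i <= k < j) (w - z k).
Proof.
move=> zw; rewrite -prodr_const_nat -big_split/= big_nat_cond.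
apply: prodr_gt0 => k; rewrite andbT => /zw.
by rewrite mulN1r opprB subr_gt0.
Qed.

Lemma increasing_zeros_root {q n z k} : increasing_zeros q n z ->
  (1 <= k <= n)%N -> root q (z k).
Proof. by move=> [_ zP] kn; apply/zP; exists k. Qed.

Lemma increasing_zeros_prod {q n z} : q \is monic -> size q = n.+1 ->
  increasing_zeros q n z -> q = \prod_(1 <= i < n.+1) ('X - (z i)%:P).
Proof.
move=> qm qs zq; have [zi _] := zq.
pose rs := [seq z i | i <- index_iota 1 n.+1].
rewrite [LHS](@all_roots_prod_XsubC _ q rs).
- by rewrite (monicP qm) scale1r big_map.
- by rewrite qs size_map size_iota subn1.
- apply/allP => w /mapP[i]; rewrite mem_index_iota ltnS => iI ->.
  exact: increasing_zeros_root zq iI.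
- rewrite uniq_rootsE map_inj_in_uniq ?iota_uniq// => i j.
  rewrite !mem_index_iota !ltnS => /andP[i1 i_n] /andP[j1 jn] zij.
  have [ij|ij|//] := ltngtP i j.
    by have := zi _ _ i1 ij jn; rewrite zij ltxx.
  by have := zi _ _ j1 ij i_n; rewrite zij ltxx.
Qed.

Lemma increasing_zeros_le {q n z i j} : increasing_zeros q n z ->
  (1 <= i)%N -> (i <= j)%N -> (j <= n)%N -> z i <= z j.
Proof.
by move=> [zi _] i1; rewrite leq_eqVlt => /predU1P[->//|ij] jn; rewrite ltW// zi.
Qed.

(** The n - k zeros to the right of w contribute a negative factor each. The end
cases k = 0 and k = n drop the condition on the missing neighbour. *)
Lemma increasing_zeros_sign {q n z k} {w : R} :
    q \is monic -> size q = n.+1 -> increasing_zeros q n z -> (k <= n)%N ->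
    ((1 <= k)%N -> z k < w) -> ((k < n)%N -> w < z k.+1) ->
  0 < (-1) ^+ (n - k) * q.[w].
Proof.
move=> qm qs zq kn kw wk.
rewrite (increasing_zeros_prod qm qs zq) horner_prod.
under eq_bigr do rewrite hornerXsubC.
rewrite (big_cat_nat (n := k.+1))//= mulrCA mulr_gt0//.
  apply: prod_subr_gt0 => i /andP[i1 ik].
  rewrite (le_lt_trans _ (kw (leq_trans i1 ik)))//.
  exact: (increasing_zeros_le zq).
rewrite -subSS; apply: prod_subr_sign => i /andP[ki i_n].
rewrite (lt_le_trans (wk (leq_trans ki i_n)))//.
exact: (increasing_zeros_le zq).
Qed.

Lemma increasing_zeros_cofactor_sign {q l n z k} :
    q \is monic -> size q = n.+1 -> increasing_zeros q n z ->
    (1 <= k <= n)%N -> q = l * ('X - (z k)%:P) ->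
  0 < (-1) ^+ (n - k) * l.[z k].
Proof.
move=> qm qs zq /andP[k1 kn] ql; have [zi _] := zq.
have : l * ('X - (z k)%:P) = (\prod_(1 <= i < k) ('X - (z i)%:P) *
    \prod_(k.+1 <= i < n.+1) ('X - (z i)%:P)) * ('X - (z k)%:P).
  rewrite -ql (increasing_zeros_prod qm qs zq).
  rewrite (big_cat_nat (n := k))//=; last exact: leqW.
  by rewrite [in X in _ * X = _]big_ltn ?ltnS// -mulrA; congr (_ * _); rewrite mulrC.
move/(mulIf (negbT (polyXsubC_eq0 _))) => ->.
rewrite hornerM !horner_prod.
under eq_bigr do rewrite hornerXsubC.
under [X in _ * (_ * X)]eq_bigr do rewrite hornerXsubC.
rewrite mulrCA mulr_gt0//.
  by apply: prod_subr_gt0 => i /andP[i1 ik]; apply: zi.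
by rewrite -subSS; apply: prod_subr_sign => i /andP[ki i_n]; apply: zi.
Qed.

(** Two increasing enumerations of n zeros among n zeros coincide: y_k is at least
z_k by induction from the left, and at most z_k by induction from the right. *)
Lemma increasing_roots_unique {q n z y} : increasing_zeros q n z ->
    (forall k, (1 <= k <= n)%N -> root q (y k)) ->
    (forall k, (1 <= k < n)%N -> y k < y k.+1) ->
  forall k, (1 <= k <= n)%N -> y k = z k.
Proof.
move=> zq yr yi; have [zi zr] := zq.
have z_le_y k : (1 <= k <= n)%N -> z k <= y k.
  elim: k => // -[_ n1|k IHk /andP[_ kn]].
    have /zr[j /andP[j1 jn] ->] := yr 1%N n1.
    exact: (increasing_zeros_le zq).
  have kn' : (1 <= k.+1 <= n)%N by rewrite /= ltnW.
  have yk : y k.+1 < y k.+2 by apply: yi; rewrite kn.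
  have /zr[j /andP[j1 jn] yE] := yr k.+2 kn.
  rewrite yE; apply: (increasing_zeros_le zq) => //; rewrite ltnNge.
  apply/negP => jk; have : z k.+1 < z j by rewrite -yE (le_lt_trans _ yk)// IHk.
  by rewrite ltNge (increasing_zeros_le zq)// ltnW.
have y_le_z i : (i < n)%N -> y (n - i)%N <= z (n - i)%N.
  elim: i => [n0|i IHi i_n].
    rewrite subn0; have n1 : (1 <= n <= n)%N by rewrite leqnn andbT.
    have /zr[j /andP[j1 jn] ->] := yr n n1.
    exact: (increasing_zeros_le zq).
  have E : (n - i)%N = (n - i.+1).+1 by rewrite subnSK// ltnW.
  have kn : (1 <= n - i.+1 <= n)%N by rewrite subn_gt0 i_n leq_subr.
  have kn2 : (1 <= n - i.+1 < n)%N by rewrite subn_gt0 i_n ltn_subrL/= (leq_trans _ i_n).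
  have yk := yi _ kn2; have := IHi (ltnW i_n); rewrite E => IH.
  have /zr[j /andP[j1 jn] yE] := yr _ kn.
  rewrite yE; apply: (increasing_zeros_le zq) => //; last by case/andP : kn.
  rewrite leqNgt; apply/negP => jk.
  have : z j < z (n - i.+1).+1 by rewrite -yE (lt_le_trans yk).
  by rewrite ltNge (increasing_zeros_le zq)//.
move=> k kn; apply/le_anti; rewrite z_le_y// andbT.
have -> : k = (n - (n - k))%N by rewrite subKn//; case/andP: kn.
by apply: y_le_z; move: kn; lia.
Qed.

(** Each box ]u_k, v_k[ contains a zero by the intermediate value theorem.
Choosing one in each gives an increasing enumeration of n zeros, hence the given
one. All localisations of zeros below are obtained this way. *)
Lemma increasing_zeros_in_boxes {q n z u v} : increasing_zeros q n z ->
    (forall k, (1 <= k <= n)%N -> u k < v k) ->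
    (forall k, (1 <= k < n)%N -> v k <= u k.+1) ->
    (forall k, (1 <= k <= n)%N -> q.[u k] * q.[v k] < 0) ->
  forall k, (1 <= k <= n)%N -> u k < z k < v k.
Proof.
move=> zq uv vu quv.
have ex k : exists w, (1 <= k <= n)%N -> [/\ u k < w, w < v k & root q w].
  have [kn|_] := boolP (1 <= k <= n)%N; last by exists 0.
  have [w] := polyrcf.poly_ivtoo (ltW (uv _ kn)) (quv _ kn).
  by rewrite in_itv/= => /andP[uw wv] qw; exists w.
have [y yP] := choice ex.
have yz := increasing_roots_unique (y := y) zq.
move=> k kn; rewrite -yz//; first by have [-> -> _] := yP _ kn.
  by move=> i /yP[].
move=> i /andP[i1 i_n].
have [_ yv _] : [/\ u i < y i, y i < v i & root q (y i)].
  by apply: yP; rewrite i1 ltnW.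
have [uy _ _] := yP i.+1 i_n.
apply: (lt_trans yv); apply: le_lt_trans uy; apply: vu; exact/andP.
Qed.

Lemma sign_change (e : nat) (r s : R) :
  0 < (-1) ^+ e.+1 * r -> 0 < (-1) ^+ e * s -> r * s < 0.
Proof.
rewrite exprS mulN1r mulNr oppr_gt0 => er es.
have : (-1) ^+ e * r * ((-1) ^+ e * s) < 0 by rewrite nmulr_rlt0.
by rewrite mulrACA -expr2 sqrr_sign mul1r.
Qed.

End zeros.

(** * Zeros of a linear pencil with interlacing members *)

Section pencil.
Context {R : realType} {n : nat} {P T : {poly R}} {B : R}.
Context {x t : nat -> R} {Z : R -> nat -> R}.
Hypotheses (P_monic : P \is monic) (P_size : size P = n.+1).
Hypotheses (T_monic : T \is monic) (T_size : size T = n.+1).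
Hypotheses (x_zeros : increasing_zeros P n x) (t_zeros : increasing_zeros T n t).
Hypothesis t_lt_x : forall k, (1 <= k <= n)%N -> t k < x k.
Hypothesis x_lt_t : forall k, (1 <= k < n)%N -> x k < t k.+1.
Hypothesis B_gt0 : 0 < B.
Hypothesis Z_zeros :
  forall N : R, 0 < N -> increasing_zeros (P + (N * B) *: T) n (Z N).

Let t_root {k} (kn : (1 <= k <= n)%N) : T.[t k] = 0.
Proof. exact/rootP/(increasing_zeros_root t_zeros). Qed.

Let T_sign {k} (w : R) : (1 <= k <= n)%N -> t k < w -> w <= x k ->
  0 < (-1) ^+ (n - k) * T.[w].
Proof.
move=> kn tw wx; have /andP[k1 kn'] := kn.
apply: (increasing_zeros_sign T_monic T_size t_zeros) => // kn2.
by rewrite (le_lt_trans wx)// x_lt_t// k1.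
Qed.

Let P_sign {k} : (1 <= k <= n)%N -> 0 < (-1) ^+ (n - k).+1 * P.[t k].
Proof.
move=> kn; have /andP[k1 kn'] := kn.
have -> : ((n - k).+1 = n - k.-1)%N by lia.
apply: (increasing_zeros_sign P_monic P_size x_zeros); first by lia.
  move=> k2; rewrite -[X in _ < t X]prednK// x_lt_t//; lia.
by move=> _; rewrite prednK// t_lt_x.
Qed.

(** At t_k the pencil reduces to P and at x_k to N B T, with opposite signs. *)
Lemma pencil_zeros_between N k : 0 < N -> (1 <= k <= n)%N -> t k < Z N k < x k.
Proof.
move=> N0 kn; apply: (increasing_zeros_in_boxes (Z_zeros _ N0)) kn => {}k kn.
- exact: t_lt_x.
- exact/ltW/x_lt_t.
- rewrite !hornerD !hornerZ t_root// (rootP (increasing_zeros_root x_zeros kn)).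
  rewrite mulr0 addr0 add0r; apply: sign_change (P_sign kn) _.
  rewrite mulrCA; apply: mulr_gt0; first exact: mulr_gt0.
  by apply: T_sign => //; exact: t_lt_x.
Qed.

(** At the k-th zero for N1 the pencil for N2 equals (N2 - N1) B T, of the sign
opposite to that of P at t_k; so ]t_k, Z_k(N1)[ are boxes for the zeros at N2. *)
Lemma pencil_zeros_decreasing N1 N2 k : 0 < N1 -> N1 < N2 -> (1 <= k <= n)%N ->
  Z N2 k < Z N1 k.
Proof.
move=> N1_gt0 N12 kn; have N2_gt0 := lt_trans N1_gt0 N12.
suff /andP[] : t k < Z N2 k < Z N1 k by [].
apply: (increasing_zeros_in_boxes (Z_zeros _ N2_gt0)) kn => {}k kn.
- by have /andP[] := pencil_zeros_between _ _ N1_gt0 kn.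
- have kn' : (1 <= k <= n)%N by lia.
  have /andP[_ zx] := pencil_zeros_between _ _ N1_gt0 kn'.
  exact/ltW/(lt_trans zx)/x_lt_t.
- have /andP[tz zx] := pencil_zeros_between _ _ N1_gt0 kn.
  have /rootP := increasing_zeros_root (Z_zeros _ N1_gt0) kn.
  rewrite !hornerD !hornerZ t_root// mulr0 addr0 => /eqP.
  rewrite addr_eq0 => /eqP ->; apply: sign_change (P_sign kn) _.
  rewrite -mulNr -mulrDl mulrCA; apply: mulr_gt0.
    by rewrite addrC -mulrBl mulr_gt0// subr_gt0.
  by apply: T_sign => //; exact: ltW.
Qed.

(** For large N the term N B T dominates at w, so that x_k can be replaced by w as
the right end of the k-th box. *)
Lemma pencil_zeros_lt_near (w : R) k : (1 <= k <= n)%N -> t k < w -> w <= x k ->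
  \forall N \near +oo, Z N k < w.
Proof.
move=> kn tw wx; have Tw := T_sign w kn tw wx.
have sT : T.[w] != 0 by apply: contraTneq Tw => ->; rewrite mulr0 ltxx.
near=> N.
have N0 : 0 < N by near: N; exact: nbhs_pinfty_gt.
(* Only the k-th box is shortened. *)
suff /andP[_] : t k < Z N k < (if k == k then w else x k) by rewrite eqxx.
apply: (increasing_zeros_in_boxes (v := fun j => if j == k then w else x j)
  (Z_zeros _ N0)) (kn) => j jn.
- by case: eqP => [->//|_]; exact: t_lt_x.
- rewrite (le_trans _ (ltW (x_lt_t _ jn)))//.
  by case: eqP => [->|].
- rewrite !hornerD !hornerZ t_root// mulr0 addr0.
  apply: sign_change (P_sign jn) _.
  case: eqP => [->|_].
    (* The value of N at which w is a zero of the pencil. *)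
    have : - P.[w] / (B * T.[w]) < N.
      by near: N; apply: nbhs_pinfty_gt; exact: num_real.
    rewrite -subr_gt0 => /(mulr_gt0 (mulr_gt0 B_gt0 Tw)).
    rewrite (_ : B * _ * _ = (-1) ^+ (n - k) * (P.[w] + N * B * T.[w]))//.
    by field; rewrite sT gt_eqF.
  rewrite (rootP (increasing_zeros_root x_zeros jn)) add0r.
  rewrite mulrCA; apply: mulr_gt0; first exact: mulr_gt0.
  by apply: T_sign => //; exact: t_lt_x.
Unshelve. all: by end_near. Qed.

Lemma pencil_zeros_cvg k : (1 <= k <= n)%N -> Z N k @[N --> +oo] --> t k.
Proof.
move=> kn; apply/cvgrPdist_lt => e e0.
(* This point lies both within e of t_k and in ]t_k, x_k]. *)
pose w := t k + Num.min (e / 2) (x k - t k).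
have tx := t_lt_x _ kn.
have tw : t k < w by rewrite ltrDl lt_min subr_gt0 tx andbT divr_gt0.
have wx : w <= x k by rewrite /w -lerBrDl ge_min lexx orbT.
have we : w < t k + e by rewrite ltrD2l gt_min; apply/orP; left; lra.
near=> N.
have N0 : 0 < N by near: N; exact: nbhs_pinfty_gt.
have zw : Z N k < w by near: N; exact: pencil_zeros_lt_near.
have /andP[tz _] := pencil_zeros_between _ _ N0 kn.
by rewrite ltr_norml; apply/andP; split; lra.
Unshelve. all: by end_near. Qed.

(** With T = S (X - t_k), the equation of the pencil at its k-th zero is solved for
N (Z_k - t_k), and the right-hand side is continuous at t_k. *)
Lemma pencil_zeros_rate k : (1 <= k <= n)%N ->
  N * (Z N k - t k) @[N --> +oo] --> - P.[t k] / (B * T^`().[t k]).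
Proof.
move=> kn.
have /factor_theorem[S TS] := increasing_zeros_root t_zeros kn.
have T'S : T^`().[t k] = S.[t k].
  by rewrite TS derivM derivXsubC mulr1 !hornerE subrr mulr0 add0r.
have S0 : S.[t k] != 0.
  have := increasing_zeros_cofactor_sign T_monic T_size t_zeros kn TS.
  by apply: contraTneq => ->; rewrite mulr0 ltxx.
rewrite T'S.
have lim : - P.[Z N k] / (B * S.[Z N k]) @[N --> +oo] --> - P.[t k] / (B * S.[t k]).
  have hc (q : {poly R}) : q.[Z N k] @[N --> +oo] --> q.[t k].
    apply: (@cvg_comp _ _ _ (fun N => Z N k) (horner q) _ (nbhs (t k))).
      exact: pencil_zeros_cvg.
    exact: continuous_horner.
  apply: cvgM; first by apply: cvgN; exact: hc.
  apply: cvgV; first by rewrite mulf_neq0// gt_eqF.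
  by apply: cvgM; [exact: cvg_cst|exact: hc].
apply: cvg_trans lim; apply: near_eq_cvg; near=> N.
have N0 : 0 < N by near: N; exact: nbhs_pinfty_gt.
have /andP[tz zx] := pencil_zeros_between _ _ N0 kn.
have /rootP := increasing_zeros_root (Z_zeros _ N0) kn.
rewrite hornerD hornerZ => /eqP; rewrite addr_eq0 => /eqP ->.
have := T_sign _ kn tz (ltW zx); rewrite TS hornerM hornerXsubC => Tz.
have SZ : S.[Z N k] != 0 by apply: contraTneq Tz => ->; rewrite mul0r mulr0 ltxx.
by field; rewrite SZ gt_eqF.
Unshelve. all: by end_near. Qed.

End pencil.

(** * Interlacing of the zeros of p_n with a and the zeros of p_(n-1)** *)

(** The index is shifted because a comes first: the zero numbered k + 1 of the
product is the zero numbered k of s. *)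
Lemma christoffel_increasing_zeros {R : realType} {s : {poly R}} {m : nat}
    {a : R} {xss : nat -> R} : increasing_zeros s m xss ->
    (forall z, root s z -> a < z) ->
  increasing_zeros (('X - a%:P) * s) m.+1
    (fun k => if k == 1%N then a else xss k.-1).
Proof.
move=> sz s_gt; have [si sr] := sz; split.
  move=> [//|i] [//|j] _ /=; rewrite !eqSS ltnS => ij jm.
  have j0 : (0 < j)%N by exact: leq_ltn_trans ij.
  rewrite [j == _]gtn_eqF//; case: eqVneq => [_|i0].
    by apply: s_gt; apply: (increasing_zeros_root sz); rewrite j0.
  by apply: si => //; rewrite lt0n.
move=> z; rewrite rootM root_XsubC; split.
  case/orP => [/eqP ->|/sr[k /andP[k0 km] ->]]; first by exists 1%N.
  by exists k.+1; rewrite ?ltnS//= eqSS gtn_eqF.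
move=> [k /andP[k0 km] ->]; case: (eqVneq k 1%N) => [_|k1]; first by rewrite eqxx.
by apply/orP; right; apply: (increasing_zeros_root sz); lia.
Qed.

(** The sign of T, hence that of s since x_k > a, alternates along the zeros of
p_(m+1), so that the intervals ]x_k, x_(k+1)[ are boxes for the zeros of s. *)
Lemma christoffel_interlacing {R : realType} {a : R} {L : {poly R} -> R}
    {p : nat -> {poly R}} {m : nat} {s : {poly R}} {x xss : nat -> R} :
    scalar L -> positive_above a L -> monic_orthogonal_form L p ->
    s \is monic -> size s = m.+1 ->
    (forall r : {poly R}, (size r <= m)%N -> L (s * r * ('X - a%:P) ^+ 2) = 0) ->
    increasing_zeros (p m.+1) m.+1 x -> increasing_zeros s m xss ->
  forall k, (1 <= k <= m)%N -> x k < xss k < x k.+1.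
Proof.
move=> Llin Lpos po sm ss so xz sz; have [pm ps _] := po; have [xi _] := xz.
have s_sign k : (1 <= k <= m.+1)%N -> 0 < (-1) ^+ (m.+1 - k) * s.[x k].
  move=> km; have /factor_theorem[l pE] := increasing_zeros_root xz km.
  have ax : a < x k.
    apply: (monic_orthogonal_root_gt _ _ _ _ _ Llin Lpos po).
    exact: (increasing_zeros_root xz).
  have := increasing_zeros_cofactor_sign (pm _) (ps _) xz km pE.
  have := christoffel_sign Llin Lpos po sm ss so _ _ pE.
  rewrite hornerM hornerXsubC -mulrA pmulr_rgt0 ?subr_gt0// => sl el.
  have := mulr_gt0 sl el.
  have l2 : 0 < l.[x k] ^+ 2.
    by rewrite exprn_even_gt0//=; apply: contraTneq sl => ->; rewrite mulr0 ltxx.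
  by rewrite (_ : _ * _ * _ = l.[x k] ^+ 2 * ((-1) ^+ (m.+1 - k) * s.[x k]));
    [rewrite pmulr_rgt0|ring].
apply: (increasing_zeros_in_boxes sz) => k km.
- by apply: xi; lia.
- by [].
- apply: (@sign_change _ (m.+1 - k.+1)).
    have -> : ((m.+1 - k.+1).+1 = m.+1 - k)%N by lia.
    by apply: s_sign; lia.
  by apply: s_sign; lia.
Qed.

(** * Asymptotics and monotonicity in the mass *)

Theorem theorem3 (R : realType)
  (mu : {measure set (measurableTypeR R) -> \bar R})
  (mu_support_infinite : infinite_set (measure_support mu))
  (mu_moments : finite_moments mu)
  (xi eta : R) (hull : convex_hull (measure_support mu) = `[xi, eta]%classic)
  (a : R) (a_le_xi : a <= xi)
  (p pss : nat -> {poly R}) (pN : R -> nat -> {poly R})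
  (p_mops : monic_orthogonal mu p)
  (pss_mops : monic_orthogonal (square_weight mu a) pss)
  (pN_mops : forall (N : R) (N_gt0 : 0 < N),
     monic_orthogonal (add_mass mu a (NngNum (ltW N_gt0))) (pN N))
  (n : nat) (n_ge1 : (1 <= n)%N)
  (x xss : nat -> R) (xN : R -> nat -> R)
  (x_zeros : increasing_zeros (p n) n x)
  (xss_zeros : increasing_zeros (pss n.-1) n.-1 xss)
  (xN_zeros : forall N : R, 0 < N -> increasing_zeros (pN N n) n (xN N)) :
  let B := CD_kernel mu p n.-1 a a in
  [/\ (forall N : R, 0 < N ->
         [/\ a < xN N 1%N,
             forall k : nat, (1 <= k <= n)%N -> xN N k < x k &
             forall k : nat, (1 <= k <= n.-1)%N ->
               x k < xss k /\ xss k < xN N k.+1]),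
      (forall k : nat, (1 <= k <= n)%N ->
         forall N1 N2 : R, 0 < N1 -> N1 < N2 -> xN N2 k < xN N1 k),
      (xN N 1%N @[N --> +oo] --> a /\
       forall k : nat, (1 <= k <= n.-1)%N -> xN N k.+1 @[N --> +oo] --> xss k) &
      (N * (xN N 1%N - a) @[N --> +oo] --> - (p n).[a] / (B * (pss n.-1).[a]) /\
       forall k : nat, (1 <= k <= n.-1)%N ->
         N * (xN N k.+1 - xss k) @[N --> +oo] -->
           - (p n).[xss k] / (B * (xss k - a) * (pss n.-1)^`().[xss k]))].
Proof.
move: n_ge1 x_zeros xss_zeros xN_zeros; case: n => [//|m] _ /=.
move=> x_zeros xss_zeros xN_zeros.
pose L (q : {poly R}) := \int[mu]_x q.[x].
have Llin : scalar L by exact: Rintegral_horner_lin.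
have supp_ge := support_ge _ _ _ _ _ hull a_le_xi.
have Lpos : positive_above a L.
  move=> q q_ge0 q0.
  exact: Rintegral_horner_gt0 mu_support_infinite supp_ge q_ge0 q0.
have horner_orth (nu : {measure set (measurableTypeR R) -> \bar R}) f g :
    \int[nu]_x (f.[x] * g.[x]) = \int[nu]_x (f * g).[x] :> R.
  by apply: eq_Rintegral => y _; rewrite hornerM.
have p_orth : monic_orthogonal_form L p.
  by have [pm ps po] := p_mops; split=> // i j /po; rewrite horner_orth.
pose L2 q := L (q * ('X - a%:P) ^+ 2).
have L2lin : scalar L2.
  by move=> c q r; rewrite /L2 mulrDl -scalerAl Llin.
have L2pos : positive_above a L2.
  move=> q q_ge0 q0; apply: Lpos; last by rewrite mulf_neq0// expf_neq0// polyXsubC_eq0.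
  by move=> y ay; rewrite hornerM horner_exp mulr_ge0 ?sqr_ge0// q_ge0.
have pss_orth : monic_orthogonal_form L2 pss.
  have [sm ss so] := pss_mops; split=> // i j /so.
  by rewrite horner_orth Rintegral_square_weight.
have [sm ss _] := pss_orth; have [pm ps _] := p_orth.
have s_orth (r : {poly R}) : (size r <= m)%N -> L (pss m * r * ('X - a%:P) ^+ 2) = 0.
  exact: monic_orthogonal_lt L2lin pss_orth.
set B := CD_kernel _ _ _ _ _.
have BE : B = \sum_(0 <= j < m.+1) (p j).[a] * (p j).[a] / L (p j ^+ 2).
  apply: eq_bigr => j _; congr (_ / _); apply: eq_Rintegral => y _.
  by rewrite horner_exp.
have B_gt0 : 0 < B by rewrite BE; exact: CD_diagonal_gt0 Lpos p_orth.
pose T := ('X - a%:P) * pss m.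
have pencil (N : R) (N0 : 0 < N) : (1 + N * B) *: pN N m.+1 = p m.+1 + (N * B) *: T.
  have Nmops := pN_mops N N0.
  pose LN q := L q + N * q.[a].
  have LNE q : \int[add_mass mu a (NngNum (ltW N0))]_x q.[x] = LN q.
    by rewrite Rintegral_add_mass.
  have LNlin : scalar LN.
    by move=> c q r; rewrite /LN Llin hornerD hornerZ; ring.
  have LNorth : monic_orthogonal_form LN (pN N).
    by have [Nm Ns No] := Nmops; split=> // i j /No; rewrite horner_orth LNE.
  rewrite BE; have [Nm Ns _] := LNorth.
  apply: (christoffel_pencil Llin Lpos p_orth _ _ s_orth) => //; first exact: ltW.
  by move=> q qs; exact: monic_orthogonal_lt LNlin LNorth qs.
(* Normalising the pencil does not move its zeros. *)
have Z_zeros (N : R) : 0 < N -> increasing_zeros (p m.+1 + (N * B) *: T) m.+1 (xN N).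
  move=> N0; rewrite -pencil//; have [xNi xNr] := xN_zeros N N0; split=> // z.
  by rewrite rootZ ?xNr// gt_eqF// addr_gt0// mulr_gt0.
have s_gt z : root (pss m) z -> a < z.
  exact: monic_orthogonal_root_gt L2lin L2pos pss_orth.
have T_zeros := christoffel_increasing_zeros xss_zeros s_gt.
set t := (fun k => _) in T_zeros.
have interl := christoffel_interlacing Llin Lpos p_orth (sm _) (ss _) s_orth
  x_zeros xss_zeros.
have t_lt_x k : (1 <= k <= m.+1)%N -> t k < x k.
  move=> km; rewrite /t; case: eqP => [->|k1].
    apply: (monic_orthogonal_root_gt _ _ _ _ _ Llin Lpos p_orth).
    exact: increasing_zeros_root x_zeros _.
  have km' : (1 <= k.-1 <= m)%N by lia.
  by have /andP[_] := interl _ km'; rewrite prednK//; case/andP: km.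
have x_lt_t k : (1 <= k < m.+1)%N -> x k < t k.+1.
  case: k => // k km; rewrite /t eqSS/=.
  by have /andP[] := interl _ km.
have Tm : T \is monic by exact: christoffel_monic.
have Ts : size T = m.+2 by exact: christoffel_size.
have tE k : (1 <= k <= m)%N -> t k.+1 = xss k by case: k.
have kS k : (1 <= k <= m)%N -> (1 <= k.+1 <= m.+1)%N by lia.
have between (N : R) k : 0 < N -> (1 <= k <= m.+1)%N -> t k < xN N k < x k.
  exact: (pencil_zeros_between (pm _) (ps _) Tm Ts x_zeros T_zeros t_lt_x x_lt_t
    B_gt0 Z_zeros).
have cvg_xN k : (1 <= k <= m.+1)%N -> xN N k @[N --> +oo] --> t k.
  exact: (pencil_zeros_cvg (pm _) (ps _) Tm Ts x_zeros T_zeros t_lt_x x_lt_t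
    B_gt0 Z_zeros).
have rate_xN k : (1 <= k <= m.+1)%N ->
    N * (xN N k - t k) @[N --> +oo] --> - (p m.+1).[t k] / (B * T^`().[t k]).
  exact: (pencil_zeros_rate (pm _) (ps _) Tm Ts x_zeros T_zeros t_lt_x x_lt_t
    B_gt0 Z_zeros).
have T' z : T^`().[z] = (pss m).[z] + (z - a) * (pss m)^`().[z].
  by rewrite /T derivM derivXsubC mul1r hornerD hornerM hornerXsubC.
split.
- move=> N N0; split.
  + by have /andP[] := between N 1%N N0 isT.
  + by move=> k km; have /andP[] := between N k N0 km.
  + move=> k km; split; first by have /andP[] := interl k km.
    by rewrite -tE//; have /andP[] := between N k.+1 N0 (kS k km).
- move=> k km N1 N2 N1_gt0 N12.
  exact: (pencil_zeros_decreasing (pm _) (ps _) Tm Ts x_zeros T_zeros t_lt_x x_lt_t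
    B_gt0 Z_zeros).
- split; first exact: (cvg_xN 1%N isT).
  by move=> k km; rewrite -tE//; exact/cvg_xN/kS.
- split.
    by have := rate_xN 1%N isT; rewrite {1 2 3}/t/= T' subrr mul0r addr0.
  move=> k km; have := rate_xN k.+1 (kS k km); rewrite tE// T'.
  by rewrite (rootP (increasing_zeros_root xss_zeros km)) add0r mulrA.
Qed.
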